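(* Let $R$ be a commutative ring with an involution $x\mapsto\bar x$ (a ring automorphism of order at most $2$), and let $n\in\mathbb{N}\cup\{\infty\}$ be either even and nonzero, or $n=\infty$. Then the map $$\lambda\colon H^0(K_1(R_n,\mathcal I_n);t)=H^0(1+\mathcal I_n)\to C(R),\qquad [\,1+aT+bT^2+\cdots\,]\mapsto[b\bar b],$$ is a well-defined isomorphism.
   Context: $R_n=R[T]/(T^{n+1})$ for $n\in\mathbb{N}$, $R_\infty=R[[T]]$, $\mathcal I_n=TR_n$; the involution is extended to $R_n$ by $\overline{\sum a_kT^k}=\sum\bar a_k\bigl(\frac{-T}{1+T}\bigr)^k$. $1+\mathcal I_n$ is the multiplicative group of units of $R_n$ congruent to $1$ modulo $\mathcal I_n$; the natural map $1+\mathcal I_n\to K_1(R_n,\mathcal I_n)$ is an isomorphism compatible with the involutions (the involution $t$ on $K_1$ being induced by conjugate transpose of matrices), and is used as an identification. $H^0(1+\mathcal I_n)=\{f\in 1+\mathcal I_n\mid f=\bar f\}/\{g\bar g\mid g\in1+\mathcal I_n\}$. $H^0(R)=\{x\in R\mid x=\bar x\}/\{x+\bar x\mid x\in R\}$, $q\colon H^0(R)\to H^0(R)$ is the homomorphism $[x]\mapsto[x^2]$, and $C(R)=\mathrm{coker}(1+q)$. *)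

(* Defs.v *)
From HB Require Import structures.
From mathcomp Require Import all_boot all_algebra.
From mathcomp Require Import boolp zify ring.

Set Implicit Arguments.
Unset Strict Implicit.
Unset Printing Implicit Defensive.

Import GRing.Theory.
Local Open Scope ring_scope.

(* An element of nat + {oo} is an [option nat], [None] standing for oo. *)
Definition in_range (n : option nat) (k : nat) : bool :=
  if n is Some m then (k <= m)%N else true.

Definition even_nonzero_or_infinite (n : option nat) : bool :=
  if n is Some m then (0 < m)%N && ~~ odd m else true.

Lemma in_range_le n k j : (j <= k)%N -> in_range n k -> in_range n j.
Proof. by case: n => //= m; apply: leq_trans. Qed.

(* R_n = R[T]/(T^(n+1)), and R_oo = R[[T]]: an element is represented by its  *)
(* sequence of coefficients, those of degree > n being 0.  {poly R} is not    *)
(* used because it excludes the zero ring.                                    *)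
Record tps (R : comPzRingType) (n : option nat) := Tps {
  coef : nat -> R;
  coef_out : forall k, ~~ in_range n k -> coef k = 0 }.

HB.instance Definition _ R n := gen_eqMixin (tps R n).
HB.instance Definition _ R n := gen_choiceMixin (tps R n).

Section Convolution.
Variable R : comPzRingType.
Implicit Types a b c : nat -> R.

Definition conv a b (k : nat) : R := \sum_(i < k.+1) a i * b (k - i)%N.

Lemma conv_rev a b k : conv a b k = \sum_(i < k.+1) a (k - i)%N * b i.
Proof.
rewrite /conv (reindex_inj rev_ord_inj) /=.
by apply: eq_bigr => i _; rewrite subSS subKn // leq_ord.
Qed.

Lemma convC a b : conv a b =1 conv b a.
Proof. by move=> k; rewrite conv_rev; apply: eq_bigr => i _; rewrite mulrC. Qed.

Lemma convA a b c k : conv a (conv b c) k = conv (conv a b) c k.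
Proof.
rewrite [RHS]conv_rev [LHS]/conv.
pose d j l := a j * (b (k - j - l)%N * c l).
transitivity (\sum_(j < k.+1) \sum_(l < k.+1 | (l <= k - j)%N) d j l).
  apply: eq_bigr => j _; rewrite conv_rev big_distrr.
  by rewrite (big_ord_narrow_leq (leq_subr _ _)).
rewrite (exchange_big_dep predT) //; apply: eq_bigr => l _.
transitivity (\sum_(j < k.+1 | (j <= k - l)%N) d j l).
  apply: eq_bigl => j; have := ltn_ord j; have := ltn_ord l; lia.
rewrite (big_ord_narrow_leq (leq_subr _ _)) /conv big_distrl.
by apply: eq_bigr => j _; rewrite /d -!subnDA addnC mulrA.
Qed.
End Convolution.

Section TruncatedPowerSeries.
Variables (R : comPzRingType) (n : option nat).
Implicit Types f g h : tps R n.

Lemma tpsP f g : (forall k, in_range n k -> coef f k = coef g k) -> f = g.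
Proof.
case: f g => [a ha] [b hb] /= ab.
have eab : a = b.
  by apply/funext => k; case: (boolP (in_range n k)) => [/ab //|nk]; rewrite ha ?hb.
by case: b / eab hb {ab} => hb; congr Tps; apply: Prop_irrelevance.
Qed.

Definition trunc (a : nat -> R) (k : nat) : R := if in_range n k then a k else 0.

Lemma trunc_out a k : ~~ in_range n k -> trunc a k = 0.
Proof. by rewrite /trunc => /negPf ->. Qed.

Definition mk_tps (a : nat -> R) : tps R n := Tps (trunc_out a).

Lemma coef_mk a k : in_range n k -> coef (mk_tps a) k = a k.
Proof. by rewrite /= /trunc => ->. Qed.

Definition tps0 := mk_tps (fun=> 0).
Definition tps1 := mk_tps (fun k => (k == 0%N)%:R).
Definition tpsN f := mk_tps (fun k => - coef f k).
Definition tpsD f g := mk_tps (fun k => coef f k + coef g k).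
Definition tpsM f g :=
  mk_tps (conv (coef f) (coef g)).

Fact tpsDA : associative tpsD.
Proof. by move=> f g h; apply: tpsP => k nk; rewrite !coef_mk // addrA. Qed.
Fact tpsDC : commutative tpsD.
Proof. by move=> f g; apply: tpsP => k nk; rewrite !coef_mk // addrC. Qed.
Fact tps0D : left_id tps0 tpsD.
Proof. by move=> f; apply: tpsP => k nk; rewrite !coef_mk // add0r. Qed.
Fact tpsND : left_inverse tps0 tpsN tpsD.
Proof. by move=> f; apply: tpsP => k nk; rewrite !coef_mk // addNr. Qed.

HB.instance Definition _ :=
  GRing.isZmodule.Build (tps R n) tpsDA tpsDC tps0D tpsND.

Fact tpsMC : commutative tpsM.
Proof. by move=> f g; apply: tpsP => k nk; rewrite !coef_mk // convC. Qed.

Fact tpsMA : associative tpsM.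
Proof.
move=> f g h; apply: tpsP => k nk; rewrite !coef_mk //.
have E (u v : tps R n) (j : nat) : (j <= k)%N ->
    coef (tpsM u v) j = conv (coef u) (coef v) j.
  by move=> jk; rewrite coef_mk //; apply: in_range_le nk.
transitivity (conv (coef f) (conv (coef g) (coef h)) k).
  by apply: eq_bigr => i _; rewrite E ?leq_subr.
rewrite convA; apply: eq_bigr => i _; rewrite E //; exact: leq_ord i.
Qed.

Fact tps1M : left_id tps1 tpsM.
Proof.
move=> f; apply: tpsP => k nk; rewrite coef_mk // /conv big_ord_recl big1 => [|i _].
  by rewrite coef_mk ?mul1r ?subn0 ?addr0 //; apply: in_range_le nk.
by rewrite coef_mk ?mul0r //; apply: in_range_le nk; apply: ltn_ord.
Qed.

Fact tpsMDl : left_distributive tpsM tpsD.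
Proof.
move=> f g h; apply: tpsP => k nk; rewrite !coef_mk // /conv -big_split.
apply: eq_bigr => i _; rewrite coef_mk; first exact: mulrDl.
by apply: in_range_le nk; apply: leq_ord.
Qed.

HB.instance Definition _ :=
  GRing.Zmodule_isComPzRing.Build (tps R n) tpsMA tpsMC tps1M tpsMDl.

Lemma coefM f g k : in_range n k ->
  coef (f * g) k = \sum_(i < k.+1) coef f i * coef g (k - i)%N.
Proof. exact: coef_mk. Qed.

Lemma coefD f g k : coef (f + g) k = coef f k + coef g k.
Proof.
case: (boolP (in_range n k)) => nk; first exact: coef_mk.
by rewrite !coef_out ?addr0.
Qed.

Lemma coefN f k : coef (- f) k = - coef f k.
Proof.
case: (boolP (in_range n k)) => nk; first exact: coef_mk.
by rewrite !coef_out ?oppr0.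
Qed.

Lemma coef1 k : coef (1 : tps R n) k = (k == 0%N)%:R.
Proof.
case: (boolP (in_range n k)) => nk; first exact: coef_mk.
by rewrite coef_out //; case: k nk => //; case: n.
Qed.

Definition tpsT : tps R n := mk_tps (fun k => (k == 1%N)%:R).

Definition inv1T : tps R n := mk_tps (fun k => (-1) ^+ k).

Lemma mul_inv1T : (1 + tpsT) * inv1T = 1.
Proof.
apply: tpsP => k nk; rewrite coefM // coef1.
have E (i : nat) : (i <= k)%N ->
    coef (1 + tpsT) i = (i == 0%N)%:R + (i == 1%N)%:R.
  by move=> ik; rewrite coefD coef1 coef_mk //; apply: in_range_le nk.
have F (i : nat) : coef inv1T (k - i) = (-1) ^+ (k - i).
  by rewrite coef_mk //; apply: in_range_le nk; apply: leq_subr.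
rewrite (eq_bigr (fun i : 'I_k.+1 =>
  ((i == 0%N :> nat)%:R + (i == 1%N :> nat)%:R) * (-1) ^+ (k - i))); last first.
  by move=> i _; rewrite E ?F // leq_ord.
case: k {nk E F} => [|k]; first by rewrite big_ord1 addr0 mul1r.
rewrite !big_ord_recl big1 => [|i _]; last by rewrite addr0 mul0r.
by rewrite /= !addr0 add0r !mul1r subn0 exprS mulN1r subn1 addNr.
Qed.

(* -T / (1 + T) *)
Definition Tbar : tps R n := - tpsT * inv1T.

Lemma coef_TbarX k j : (j < k)%N -> coef (Tbar ^+ k) j = 0.
Proof.
elim: k j => // k IH j jk.
case: (boolP (in_range n j)) => nj; last by rewrite coef_out.
rewrite exprS coefM // big1 // => i _.
have ij : (i <= j)%N by apply: leq_ord.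
have nI : in_range n i by apply: in_range_le nj.
have [i0|i_gt0] := posnP i.
  rewrite i0 in nI *; rewrite coefM // big_ord1 coefN coef_mk //.
  by rewrite oppr0 !mul0r.
by rewrite [X in _ * X]IH ?mulr0 //; lia.
Qed.

End TruncatedPowerSeries.

Section Involution.
Variables (R : comPzRingType) (conj : {rmorphism R -> R}) (n : option nat).
Implicit Types f g : tps R n.

(* The coefficient of T^m in \sum_k conj(a_k) (-T / (1 + T))^k, which only    *)
(* involves the terms with k <= m, see [coef_TbarX].                          *)
Definition bar f : tps R n :=
  mk_tps n (fun m => \sum_(k < m.+1) conj (coef f k) * coef (Tbar R n ^+ k) m).

Lemma coef_bar N f m : in_range n m -> (m < N)%N ->
  coef (bar f) m = \sum_(k < N) conj (coef f k) * coef (Tbar R n ^+ k) m.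
Proof.
move=> nm mN; rewrite coef_mk //.
rewrite (big_ord_widen N (fun k => conj (coef f k) * coef (Tbar R n ^+ k) m)) //.
rewrite [RHS](bigID (fun k : 'I_N => (k < m.+1)%N)) /=.
rewrite [X in _ + X]big1 ?addr0 // => k.
by rewrite ltnS -ltnNge => mk; rewrite coef_TbarX ?mulr0.
Qed.

Fact bar_additive : zmod_morphism bar.
Proof.
move=> f g; apply: tpsP => m nm; rewrite coefD coefN !coef_mk // -sumrB.
by apply: eq_bigr => k _; rewrite coefD coefN rmorphB mulrBl.
Qed.

Fact bar_multiplicative : monoid_morphism bar.
Proof.
split=> [|f g]; apply: tpsP => m nm.
  rewrite coef_mk // coef1 big_ord_recl big1 => [|k _].
    by rewrite coef1 rmorph1 mul1r addr0 expr0 coef1.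
  by rewrite coef1 rmorph0 mul0r.
pose U k := coef (Tbar R n ^+ k).
pose F k l := conj (coef f k) * conj (coef g l) * U (k + l)%N m.
transitivity (\sum_(k < m.+1) \sum_(0 <= l < m.+1 - k) F k l).
  rewrite coef_mk //.
  transitivity (\sum_(p < m.+1) \sum_(k < m.+1 | (k <= p)%N) F k (p - k)%N).
    apply: eq_bigr => p _; have pm : (p <= m)%N by apply: leq_ord.
    rewrite coefM; last exact: in_range_le nm.
    rewrite rmorph_sum big_distrl (big_ord_narrow_leq pm).
    apply: eq_bigr => k _; rewrite /F rmorphM subnKC //; exact: leq_ord.
  rewrite (exchange_big_dep predT) //; apply: eq_bigr => k _.
  have km : (k <= m.+1)%N by apply: ltnW.
  rewrite -(big_mkord (fun p => (k <= p)%N) (fun p => F k (p - k)%N)).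
  rewrite (big_cat_nat _ km) //= big_nat_cond big1 ?add0r; last first.
    by move=> p; rewrite leq0n /= andbC leqNgt andNb.
  rewrite -{1}[k : nat]add0n big_addn big_mkcond.
  by apply: eq_bigr => l _; rewrite leq_addl addnK.
rewrite coefM //.
pose G k l := conj (coef f k) * conj (coef g l).
transitivity (\sum_(i < m.+1) \sum_(k < m.+1) \sum_(l < m.+1)
    G k l * (U k i * U l (m - i)%N)); last first.
  apply: eq_bigr => i _; have im : (i <= m)%N by apply: leq_ord.
  rewrite (@coef_bar m.+1) ?(in_range_le im) ?ltnS //.
  rewrite (@coef_bar m.+1) ?(in_range_le (leq_subr i m)) ?ltnS ?leq_subr //.
  rewrite big_distrl; apply: eq_bigr => k _; rewrite big_distrr.
  by apply: eq_bigr => l _; rewrite /G mulrACA.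
rewrite exchange_big; apply: eq_bigr => k _.
rewrite exchange_big.
transitivity (\sum_(l < m.+1) F k l); last first.
  apply: eq_bigr => l _; rewrite -big_distrr; congr (_ * _).
  by rewrite /U exprD coefM.
have mk := leq_subr k m.+1.
rewrite -(big_mkord predT (F k)) (big_cat_nat _ mk) //=.
rewrite [X in _ + X]big_nat_cond [X in _ + X]big1 ?addr0 // => l.
rewrite andbT => /andP[ml _]; rewrite /F /U coef_TbarX ?mulr0 //.
by move: (ltn_ord k) ml; lia.
Qed.

HB.instance Definition _ :=
  GRing.isZmodMorphism.Build (tps R n) (tps R n) bar bar_additive.
HB.instance Definition _ :=
  GRing.isMonoidMorphism.Build (tps R n) (tps R n) bar bar_multiplicative.

End Involution.

Lemma bar_T R conj n : @bar R conj n (tpsT R n) = Tbar R n.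
Proof.
apply: tpsP => m nm.
have T (k : nat) : (k <= m)%N -> k != 1%N -> conj (coef (tpsT R n) k) = 0.
  move=> km /negPf k1; rewrite coef_mk ?k1 ?rmorph0 //.
  by apply: in_range_le nm.
rewrite coef_mk //; case: m nm T => [|m] nm T.
  by rewrite big_ord1 T // mul0r -[Tbar R n]expr1 coef_TbarX.
rewrite 2!big_ord_recl big1 => [|k _]; last by rewrite T ?mul0r //; apply: ltn_ord.
rewrite T // mul0r add0r addr0 expr1 coef_mk ?rmorph1 ?mul1r //.
by apply: in_range_le nm.
Qed.

Section OnePlus.
Variables (R : comPzRingType) (n : option nat).
Implicit Types f g : tps R n.

(* I_n = T R_n *)
Definition aug_ideal f : Prop := exists h, f = tpsT R n * h.

Definition is_one_plus : {pred tps R n} :=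
  [pred f | `[< (exists g, f * g = 1) /\ aug_ideal (f - 1) >]].

(* The multiplicative group 1 + I_n.  Its law is written additively (see      *)
(* [one_plus_valD]), as the library's quotient groups are those of zmodTypes. *)
Record one_plus := OnePlus { one_plus_val : tps R n; _ : is_one_plus one_plus_val }.

HB.instance Definition _ := [isSub for one_plus_val].
HB.instance Definition _ := [Choice of one_plus by <:].

Fact is_one_plus1 : is_one_plus 1.
Proof.
apply/asboolP; split; first by exists 1; rewrite mulr1.
by exists 0; rewrite subrr mulr0.
Qed.

Fact is_one_plusM f g : is_one_plus f -> is_one_plus g -> is_one_plus (f * g).
Proof.
move=> /asboolP[[f' ff'] [h fh]] /asboolP[[g' gg'] [k gk]].
apply/asboolP; split; first by exists (f' * g'); rewrite mulrACA ff' gg' mulr1.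
exists (f * k + h); rewrite mulrDr mulrCA -gk -fh.
by rewrite mulrBr mulr1 addrA subrK.
Qed.

Fact one_plus_inv_subproof (u : one_plus) :
  exists v : one_plus, val v * val u = 1.
Proof.
case: u => f fP /=; move: (fP) => /asboolP[[g fg] [h fh]].
suff gP : is_one_plus g by exists (OnePlus gP); rewrite mulrC.
apply/asboolP; split; first by exists f; rewrite mulrC.
by exists (- (h * g)); rewrite mulrN mulrA -fh mulrBl fg mul1r opprB.
Qed.

Definition one_plus_one : one_plus := OnePlus is_one_plus1.
Definition one_plus_mul (u v : one_plus) : one_plus :=
  OnePlus (is_one_plusM (valP u) (valP v)).
Definition one_plus_inv (u : one_plus) : one_plus :=
  sval (cid (one_plus_inv_subproof u)).

Fact one_plus_mulA : associative one_plus_mul.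
Proof. by move=> u v w; apply: val_inj; apply: mulrA. Qed.
Fact one_plus_mulC : commutative one_plus_mul.
Proof. by move=> u v; apply: val_inj; apply: mulrC. Qed.
Fact one_plus_mul1 : left_id one_plus_one one_plus_mul.
Proof. by move=> u; apply: val_inj; apply: mul1r. Qed.
Fact one_plus_mulV : left_inverse one_plus_one one_plus_inv one_plus_mul.
Proof.
by move=> u; apply: val_inj; apply: (svalP (cid (one_plus_inv_subproof u))).
Qed.

HB.instance Definition _ := GRing.isZmodule.Build one_plus
  one_plus_mulA one_plus_mulC one_plus_mul1 one_plus_mulV.

Lemma one_plus_valD (u v : one_plus) : val (u + v) = val u * val v.
Proof. by []. Qed.

Variable conj : {rmorphism R -> R}.

Fact is_one_plus_bar f : is_one_plus f -> is_one_plus (bar conj f).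
Proof.
move=> /asboolP[[g fg] [h fh]]; apply/asboolP; split.
  by exists (bar conj g); rewrite -rmorphM fg rmorph1.
exists (- (inv1T R n * bar conj h)).
by rewrite -(rmorph1 (@bar R conj n)) -rmorphB fh rmorphM /= bar_T /Tbar mulrN mulrA !mulNr.
Qed.

Definition one_plus_bar (u : one_plus) : one_plus :=
  OnePlus (is_one_plus_bar (valP u)).

Fact one_plus_bar_additive : zmod_morphism one_plus_bar.
Proof.
have D u v : one_plus_bar (u + v) = one_plus_bar u + one_plus_bar v.
  by apply: val_inj; rewrite /= rmorphM.
by move=> u v; apply: (addIr (one_plus_bar v)); rewrite -D !subrK.
Qed.

HB.instance Definition _ :=
  GRing.isZmodMorphism.Build one_plus one_plus one_plus_bar one_plus_bar_additive.

End OnePlus.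

Arguments one_plus_bar {R} n conj u.

Section Tate.
Variables (A : zmodType) (t : {additive A -> A}).

Definition is_invariant : {pred A} := [pred a | t a == a].

Fact is_invariant_zmod_closed : zmod_closed is_invariant.
Proof.
split=> [|a b]; first by rewrite inE raddf0.
by rewrite !inE raddfB => /eqP -> /eqP ->.
Qed.
HB.instance Definition _ :=
  GRing.isZmodClosed.Build A is_invariant is_invariant_zmod_closed.

Record invariants :=
  Invariants { invariants_val : A; _ : is_invariant invariants_val }.

HB.instance Definition _ := [isSub for invariants_val].
HB.instance Definition _ := [Choice of invariants by <:].
HB.instance Definition _ := [SubChoice_isSubZmodule of invariants by <:].

Definition is_norm : {pred invariants} :=
  [pred a | `[< exists b, val a = b + t b >]].

Fact is_norm_zmod_closed : zmod_closed is_norm.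
Proof.
split=> [|a b]; rewrite !inE; first by apply/asboolP; exists 0; rewrite raddf0 addr0.
move=> /asboolP[c ac] /asboolP[d bd]; apply/asboolP; exists (c - d).
have -> : val (a - b) = val a - val b by apply: raddfB.
by rewrite ac bd raddfB opprD addrACA.
Qed.
HB.instance Definition _ :=
  GRing.isZmodClosed.Build invariants is_norm is_norm_zmod_closed.

(* {a | t a = a} / {b + t b | b in A} *)
Definition H0 := Quotient.quot is_norm.
HB.instance Definition _ := GRing.Zmodule.on H0.

Definition H0_class (a : invariants) : H0 := \pi_(Quotient.quot is_norm)%qT a.

Lemma H0_classP a b :
  H0_class a = H0_class b <-> exists c, val a - val b = c + t c.
Proof.
rewrite -raddfB; split=> [/eqP|] E.
  by move: E; rewrite /H0_class -Quotient.idealrBE inE => /asboolP.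
by apply/eqP; rewrite /H0_class -Quotient.idealrBE inE; apply/asboolP.
Qed.

Lemma H0_class_surj X : exists a, H0_class a = X.
Proof. by exists (repr X); apply: reprK. Qed.

Fact H0_class_additive : zmod_morphism H0_class.
Proof. by move=> a b; apply: (raddfB (\pi_(Quotient.quot is_norm)%qT)). Qed.
HB.instance Definition _ :=
  GRing.isZmodMorphism.Build invariants H0 H0_class H0_class_additive.

End Tate.

Section Cokernel.
Variables (A B : zmodType) (f : {additive A -> B}).

Definition in_image : {pred B} := [pred y | `[< exists x, y = f x >]].

Fact in_image_zmod_closed : zmod_closed in_image.
Proof.
split=> [|y z]; rewrite !inE; first by apply/asboolP; exists 0; rewrite raddf0.
by move=> /asboolP[a ->] /asboolP[b ->]; apply/asboolP; exists (a - b); rewrite raddfB.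
Qed.
HB.instance Definition _ :=
  GRing.isZmodClosed.Build B in_image in_image_zmod_closed.

Definition coker := Quotient.quot in_image.
HB.instance Definition _ := GRing.Zmodule.on coker.

Definition coker_class (y : B) : coker := \pi_(Quotient.quot in_image)%qT y.

End Cokernel.

Section CokernelOnePlusQ.
Variables (R : comPzRingType) (conj : {rmorphism R -> R}).

Lemma conj_invariant (x : invariants conj) : conj (val x) = val x.
Proof. exact: eqP (valP x). Qed.

Lemma H0_conjP (x y : invariants conj) :
  H0_class x = H0_class y <-> exists c, val x - val y = c + conj c.
Proof. exact: H0_classP. Qed.

Fact is_invariant_sqr (x : invariants conj) : is_invariant conj (val x ^+ 2).
Proof.
by apply/eqP; apply: etrans (rmorphXn conj 2 (val x)) _; rewrite conj_invariant.
Qed.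

Definition invariants_sqr (x : invariants conj) : invariants conj :=
  Invariants (is_invariant_sqr x).

Definition q (X : H0 conj) : H0 conj := H0_class (invariants_sqr (repr X)).

Lemma q_class x : q (H0_class x) = H0_class (invariants_sqr x).
Proof.
have /H0_conjP[c] : H0_class (repr (H0_class x)) = H0_class x by apply: reprK.
rewrite /q; set y := repr _ => /eqP; rewrite subr_eq => /eqP E.
have : conj (c + conj c + val x) = c + conj c + val x by rewrite -E conj_invariant.
rewrite !rmorphD conj_invariant => /addIr; rewrite addrC => /addIr cc.
apply/H0_conjP; exists (val x * (c + conj c) + c * (c + conj c)).
rewrite -[val (invariants_sqr y)]/(val y ^+ 2) -[val (invariants_sqr x)]/(val x ^+ 2).
rewrite rmorphD !rmorphM rmorphD cc conj_invariant E.
set u := val x; set d := conj c; ring.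
Qed.

Fact q_additive : zmod_morphism q.
Proof.
have D X Y : q (X + Y) = q X + q Y.
  have [x <-] := H0_class_surj X; have [y <-] := H0_class_surj Y.
  rewrite -raddfD !q_class -raddfD; apply/H0_conjP; exists (val x * val y).
  change ((val x + val y) ^+ 2 - (val x ^+ 2 + val y ^+ 2) =
          val x * val y + conj (val x * val y)).
  rewrite rmorphM !conj_invariant; set u := val x; set v := val y; ring.
by move=> X Y; apply: (addIr (q Y)); rewrite -D !subrK.
Qed.
HB.instance Definition _ := GRing.isZmodMorphism.Build (H0 conj) (H0 conj) q q_additive.

Definition one_plus_q (X : H0 conj) : H0 conj := X + q X.

Fact one_plus_q_additive : zmod_morphism one_plus_q.
Proof. by move=> X Y; rewrite /one_plus_q raddfB opprD addrACA. Qed.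
HB.instance Definition _ :=
  GRing.isZmodMorphism.Build (H0 conj) (H0 conj) one_plus_q one_plus_q_additive.

Definition C := coker one_plus_q.
HB.instance Definition _ := GRing.Zmodule.on C.

Definition C_class (X : H0 conj) : C := coker_class one_plus_q X.

Hypothesis conjK : involutive conj.

Fact is_invariant_norm b : is_invariant conj (b * conj b).
Proof. by apply/eqP; apply: etrans (rmorphM conj _ _) _; rewrite conjK mulrC. Qed.

Definition norm b : invariants conj := Invariants (is_invariant_norm b).

End CokernelOnePlusQ.

(* Main.v *)
(* Filter 1 + I_n by the subgroups 1 + T^k R_n.  The involution acts on the
   k-th graded piece R by (-1)^k conj, and for k odd, k >= 3, the connecting
   maps between the pieces k and k + 1 are multiplication by k on Tate
   cohomology, which is killed by 2, hence bijective: up to a norm, an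
   invariant congruent to 1 modulo T^k is congruent to 1 modulo T^(k+2).  As n
   is even or infinite, the pieces pair off, and a T-adic limit shows that
   every invariant congruent to 1 modulo T^3 is a norm.  For k = 1 the product
   (1 + x T) bar(1 + x T) = 1 + (x - x^2) T^2 + O(T^3), with conj x = x,
   accounts for the cokernel of 1 + q.  If 1 + a T + b T^2 + ... is invariant
   then a = conj b - b, which makes its class |-> [b conj b] additive, and
   surjectivity comes from the invariants 1 - x T bar(T) = 1 + x T^2 + ... *)
From HB Require Import structures.
From mathcomp Require Import all_boot all_algebra.
From mathcomp Require Import boolp zify ring.
Require Import Defs.
Import GRing.Theory.
Local Open Scope ring_scope.
Set Implicit Arguments.
Unset Strict Implicit.
Unset Printing Implicit Defensive.

(** * T-adic valuation and units of the form 1 + T f *)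

Section Valuation.
Variables (R : comPzRingType) (n : option nat).
Implicit Types f g h : tps R n.

Definition val_ge k f : Prop := forall j, (j < k)%N -> coef f j = 0.

Lemma coefB f g k : coef (f - g) k = coef f k - coef g k.
Proof. by rewrite coefD coefN. Qed.

Lemma coef_sum (F : nat -> tps R n) N k :
  coef (\sum_(i < N) F i) k = \sum_(i < N) coef (F i) k.
Proof.
elim: N => [|N IH]; last by rewrite !big_ord_recr coefD IH.
rewrite !big_ord0; case: (boolP (in_range n k)) => nk; last exact: coef_out.
exact: coef_mk.
Qed.

Lemma val_geD k f g : val_ge k f -> val_ge k g -> val_ge k (f + g).
Proof. by move=> hf hg j jk; rewrite coefD hf ?hg ?addr0. Qed.

Lemma val_geN k f : val_ge k f -> val_ge k (- f).
Proof. by move=> hf j jk; rewrite coefN hf ?oppr0. Qed.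

Lemma val_geW k l f : (l <= k)%N -> val_ge k f -> val_ge l f.
Proof. by move=> lk hf j jl; apply: hf; apply: leq_trans jl lk. Qed.

Lemma val_geM k l f g : val_ge k f -> val_ge l g -> val_ge (k + l) (f * g).
Proof.
move=> hf hg j jkl; case: (boolP (in_range n j)) => nj; last exact: coef_out.
rewrite coefM // big1 // => i _.
have [ik|ki] := ltnP i k; first by rewrite hf ?mul0r.
by rewrite hg ?mulr0 //; have := ltn_ord i; lia.
Qed.

Lemma val_geMl k f g : val_ge k f -> val_ge k (g * f).
Proof. by move=> hf; rewrite -[k]add0n; apply: val_geM. Qed.

Lemma val_geX k f : val_ge 1 f -> val_ge k (f ^+ k).
Proof.
move=> hf; elim: k => [//|k IH]; rewrite exprS -[k.+1]add1n; exact: val_geM.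
Qed.

Lemma coefM_lead k l f g : val_ge k f -> val_ge l g -> in_range n (k + l) ->
  coef (f * g) (k + l) = coef f k * coef g l.
Proof.
move=> hf hg nkl; have kP : (k < (k + l).+1)%N by lia.
rewrite coefM // (bigD1 (Ordinal kP)) //= addKn big1 ?addr0 // => i.
rewrite -val_eqE /= => ik; have := ltn_ord i => il.
have [lik|kil] := ltnP i k; first by rewrite hf ?mul0r.
by rewrite hg ?mulr0 //; lia.
Qed.

Lemma coefM_next k l f g : val_ge k f -> val_ge l g -> in_range n (k + l).+1 ->
  coef (f * g) (k + l).+1 = coef f k * coef g l.+1 + coef f k.+1 * coef g l.
Proof.
move=> hf hg nkl; have kP : (k < (k + l).+2)%N by lia.
have kP' : (k.+1 < (k + l).+2)%N by lia.
rewrite coefM // (bigD1 (Ordinal kP)) //= (bigD1 (Ordinal kP')) /=; last first.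
  by rewrite -val_eqE /=; lia.
rewrite big1 => [|i]; first by rewrite addr0 subSS addKn -addnS addKn.
rewrite -!val_eqE /= => /andP[ik ik']; have := ltn_ord i => il.
have [lik|kil] := ltnP i k; first by rewrite hf ?mul0r.
by rewrite hg ?mulr0 //; lia.
Qed.

Lemma coef_T k : in_range n k -> coef (tpsT R n) k = (k == 1%N)%:R.
Proof. exact: coef_mk. Qed.

Lemma val_geT : val_ge 1 (tpsT R n).
Proof.
case=> // _; case: (boolP (in_range n 0)) => n0; last exact: coef_out.
by rewrite coef_T.
Qed.

Lemma coefTM k f : in_range n k.+1 -> coef (tpsT R n * f) k.+1 = coef f k.
Proof.
move=> nk; rewrite coefM //; have kP : (1 < k.+2)%N by [].
rewrite (bigD1 (Ordinal kP)) // big1 => [|i]; last first.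
  rewrite -val_eqE => /negPf i1; rewrite coef_T; first by rewrite i1 mul0r.
  by apply: in_range_le nk; apply: leq_ord.
rewrite [LHS]addr0 coef_T; first by rewrite mul1r subSS subn0.
by apply: in_range_le nk.
Qed.

Lemma aug_idealP f : val_ge 1 f -> aug_ideal f.
Proof.
move=> hf; exists (mk_tps n (fun k => coef f k.+1)); apply: tpsP => -[|k] nk.
  by rewrite hf // -[tpsT R n * _]/(_ * _) (val_geM (l := 0) val_geT).
by rewrite coefTM // coef_mk //; apply: in_range_le nk.
Qed.

Lemma val_ge_aug_ideal f : aug_ideal f -> val_ge 1 f.
Proof. by case=> g ->; rewrite mulrC; apply: val_geMl val_geT. Qed.

(** Geometric series: since e^i starts in degree i, the coefficient of T^m in the inverse is that of
    the partial sum with m + 1 terms. *)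
Lemma val_ge_unit e : val_ge 1 e -> exists g, (1 - e) * g = 1.
Proof.
move=> he; pose S N := \sum_(i < N) e ^+ i.
pose g := mk_tps n (fun m => coef (S m.+1) m).
have gS m : val_ge m (g - S m).
  move=> j jm; rewrite coefB; case: (boolP (in_range n j)) => nj; last first.
    by rewrite !coef_out ?subrr.
  rewrite coef_mk // !coef_sum.
  rewrite (big_ord_widen m (fun i => coef (e ^+ i) j)) // big_mkcond -sumrB.
  rewrite big1 // => i _; rewrite ltnS; case: leqP => ji; rewrite ?subrr //.
  by rewrite (val_geX he) ?subr0.
exists g; apply: tpsP => m nm; apply/eqP; rewrite -subr_eq0 -coefB; apply/eqP.
have -> : (1 - e) * g - 1 = (1 - e) * (g - S m.+1) - e ^+ m.+1.
  have <- : 1 - (1 - e) * S m.+1 = e ^+ m.+1; last by ring.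
  by rewrite /S -[1 - e]opprB mulNr -subrX1 opprB subKr.
have hS : val_ge m.+1 ((1 - e) * (g - S m.+1)) by apply: val_geMl.
exact: val_geD hS (val_geN (val_geX he)) m (ltnSn m).
Qed.

(** The unit condition is automatic by the geometric series, so membership only concerns the
    constant coefficient. *)
Lemma is_one_plusP f : reflect (val_ge 1 (f - 1)) (is_one_plus f).
Proof.
apply: (iffP idP) => [/asboolP[_]|hf]; first exact: val_ge_aug_ideal.
apply/asboolP; split; last exact: aug_idealP.
have [g] := val_ge_unit (val_geN hf).
by rewrite opprK addrC subrK; exists g.
Qed.

Fact one_plus_of_subproof (a : nat -> R) :
  is_one_plus (1 + tpsT R n * mk_tps n (fun k => a k.+1)).
Proof.
apply/is_one_plusP; rewrite addrC addKr mulrC; exact: val_geMl val_geT.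
Qed.

(** The value [a 0] is ignored, the constant coefficient being forced to be 1. *)
Definition one_plus_of (a : nat -> R) : one_plus R n :=
  OnePlus (one_plus_of_subproof a).

Lemma coef_one_plus_of a k : in_range n k.+1 ->
  coef (val (one_plus_of a)) k.+1 = a k.+1.
Proof.
move=> nk; rewrite coefD coef1 add0r coefTM // coef_mk //.
by apply: in_range_le nk.
Qed.

Lemma coef0_one_plus (u : one_plus R n) : coef (val u) 0 = 1.
Proof.
have /is_one_plusP/(_ 0%N isT) := valP u.
by rewrite coefB coef1 => /eqP; rewrite subr_eq0 => /eqP.
Qed.

(** The cross term (u - 1)(v - 1) starts in degree 2 k; below that degree the group law is addition
    of coefficients. *)
Lemma coefM_one_plus j k (u v : one_plus R n) :
    val_ge k (val u - 1) -> val_ge k (val v - 1) -> (0 < j < k + k)%N ->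
  coef (val (u + v)) j = coef (val u) j + coef (val v) j.
Proof.
move=> hu hv /andP[j0 jk]; rewrite one_plus_valD.
have -> : val u * val v = (val u - 1) * (val v - 1) + val u + val v - 1 by ring.
by rewrite coefB !coefD (val_geM hu hv) // coef1 (gtn_eqF j0) subr0 add0r.
Qed.

Lemma coef2_one_plusD (u v : one_plus R n) : in_range n 2 ->
  coef (val (u + v)) 2 =
  coef (val u) 2 + coef (val v) 2 + coef (val u) 1 * coef (val v) 1.
Proof.
move=> n2; rewrite one_plus_valD.
have -> : val u * val v = (val u - 1) * (val v - 1) + val u + val v - 1 by ring.
have /is_one_plusP hu := valP u; have /is_one_plusP hv := valP v.
rewrite coefB !coefD -[2%N]/(1 + 1)%N (coefM_lead hu hv) // !coefB !coef1 /=.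
by rewrite !subr0 -addrA addrC.
Qed.

(** * The T-adic filtration of 1 + I_n *)

Definition eq1_mod k (u : one_plus R n) : Prop := val_ge k (val u - 1).

Lemma eq1_mod1 u : eq1_mod 1 u.
Proof. exact/is_one_plusP/(valP u). Qed.

Lemma one_plus_val0 : val (0 : one_plus R n) = 1.
Proof. by []. Qed.

Lemma one_eq1_mod k : eq1_mod k 0.
Proof.
by move=> j _; rewrite coefB one_plus_val0 subrr.
Qed.

Lemma eq1_modD k u v : eq1_mod k u -> eq1_mod k v -> eq1_mod k (u + v).
Proof.
rewrite /eq1_mod one_plus_valD => hu hv.
have -> : val u * val v - 1 = val u * (val v - 1) + (val u - 1) by ring.
by apply: val_geD => //; apply: val_geMl.
Qed.

(** On the left [u - v] is the quotient u / v in the group, on the right the difference is taken in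
    the ring; the two are related through the unit v. *)
Lemma eq1_modB_val k u v : eq1_mod k (u - v) <-> val_ge k (val u - val v).
Proof.
have E : val u = val v * val (u - v) by rewrite -one_plus_valD addrC subrK.
split=> h.
  have -> : val u - val v = val v * (val (u - v) - 1) by rewrite mulrBr mulr1 -E.
  exact: val_geMl.
have V : val (- v) * val v = 1 by rewrite -one_plus_valD addNr.
rewrite /eq1_mod; have -> : val (u - v) - 1 = val (- v) * (val u - val v).
  by rewrite mulrBr V [in RHS]mulrC -one_plus_valD.
exact: val_geMl.
Qed.

Lemma eq1_modN k u : eq1_mod k u -> eq1_mod k (- u).
Proof.
move=> hu; rewrite -[- u]add0r; apply/eq1_modB_val.
by rewrite -opprB; apply: val_geN.
Qed.

Lemma eq1_mod_eq0 u : (forall k, eq1_mod k u) -> u = 0.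
Proof.
move=> hu; apply: val_inj; apply: tpsP => k _.
by apply/eqP; rewrite -subr_eq0 -coefB one_plus_val0 (hu k.+1).
Qed.

End Valuation.

(** * The involution on leading coefficients *)

Section Bar.
Variables (R : comPzRingType) (conj : {rmorphism R -> R}) (n : option nat).
Hypothesis conjK : involutive conj.
Implicit Types h : tps R n.

Let Tb := Tbar R n.

Lemma val_geTbar : val_ge 1 Tb.
Proof. by move=> j j1; rewrite -[Tb]expr1 coef_TbarX. Qed.

Lemma coef_Tbar k : in_range n k.+1 -> coef Tb k.+1 = (-1) ^+ k.+1.
Proof.
move=> nk; rewrite /Tb /Tbar mulNr coefN coefTM // coef_mk ?exprS ?mulN1r //.
by apply: in_range_le nk.
Qed.

Lemma coef_TbarX_lead k : in_range n k -> coef (Tb ^+ k) k = (-1) ^+ k.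
Proof.
elim: k => [|k IH] nk; first by rewrite expr0 coef1.
rewrite exprS -[k.+1]add1n (coefM_lead val_geTbar (val_geX val_geTbar)) //.
rewrite coef_Tbar ?(in_range_le _ nk) // IH -?exprD //.
by apply: in_range_le nk.
Qed.

(** Here Tb^k = (-T)^k (1 + T)^(-k), and (1 + T)^(-k) begins with 1 - k T. *)
Lemma coef_TbarX_next k : in_range n k.+1 ->
  coef (Tb ^+ k) k.+1 = (-1) ^+ k.+1 * k%:R.
Proof.
elim: k => [|k IH] nk; first by rewrite expr0 coef1 mulr0.
have nk1 : in_range n k.+1 by apply: in_range_le nk.
rewrite exprS -[k.+2]/(1 + k).+1.
rewrite (coefM_next val_geTbar (val_geX val_geTbar)) // IH //.
rewrite coef_TbarX_lead ?(in_range_le _ nk1) // !coef_Tbar ?(in_range_le _ nk) //.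
rewrite add1n -[in RHS]natr1 !exprS expr0.
set e := (-1) ^+ k; ring.
Qed.

Lemma coef_bar_lead k h : val_ge k h -> in_range n k ->
  coef (bar conj h) k = (-1) ^+ k * conj (coef h k).
Proof.
move=> hh nk; rewrite coef_mk // big_ord_recr big1 => [|i _]; last first.
  by rewrite /= (hh _ (ltn_ord i)) rmorph0 mul0r.
by rewrite /= add0r coef_TbarX_lead // mulrC.
Qed.

Lemma coef_bar_next k h : val_ge k h -> in_range n k.+1 ->
  coef (bar conj h) k.+1 =
  (-1) ^+ k.+1 * (conj (coef h k.+1) + k%:R * conj (coef h k)).
Proof.
move=> hh nk; rewrite coef_mk // !big_ord_recr big1 => [|i _]; last first.
  by rewrite /= (hh _ (ltn_ord i)) rmorph0 mul0r.
rewrite /= add0r coef_TbarX_next // coef_TbarX_lead //.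
set e := (-1) ^+ k.+1; ring.
Qed.

Lemma val_ge_bar k h : val_ge k h -> val_ge k (bar conj h).
Proof.
move=> hh j jk; case: (boolP (in_range n j)) => nj; last exact: coef_out.
rewrite coef_mk // big1 // => i _; rewrite hh ?rmorph0 ?mul0r //.
by have := ltn_ord i; lia.
Qed.

(** As (1 + Tb)(1 + T) = 1, the involution exchanges 1 + T and its inverse. *)
Lemma bar_Tbar : bar conj Tb = tpsT R n.
Proof.
set T := tpsT R n; have TI : (1 + T) * inv1T R n = 1 := mul_inv1T R n.
have TbT : (1 + Tb) * (1 + T) = 1.
  rewrite mulrC mulrDr mulr1 /Tb /Tbar mulrCA TI mulr1 -/T; ring.
have bI : bar conj (inv1T R n) = 1 + T.
  have := congr1 (@bar _ conj n) TI.
  rewrite rmorphM rmorphD /= bar_T !rmorph1 -/Tb => E.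
  by rewrite -[LHS]mul1r -[X in X * _]TbT mulrAC E mul1r.
rewrite {1}/Tb {1}/Tbar rmorphM rmorphN /= bar_T bI /Tbar -/T.
by rewrite !mulNr opprK mulrAC -mulrA TI mulr1.
Qed.

Lemma coef_TX l m : in_range n m -> coef (tpsT R n ^+ l) m = (m == l)%:R.
Proof.
elim: l m => [|l IH] [|m] nm; rewrite ?expr0 ?coef1 //.
  by rewrite (val_geX (val_geT R n)).
by rewrite exprS coefTM // IH //; apply: in_range_le nm.
Qed.

(** Applying [bar] twice replaces T^l by bar(Tb^l) = T^l. In a fixed degree m only l <= m
    contributes, so the two sums are finite and can be exchanged. *)
Lemma barK : involutive (@bar R conj n).
Proof.
move=> f; apply: tpsP => m nm; rewrite [LHS]coef_mk //.
pose t l k := coef (Tb ^+ l) k.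
transitivity (\sum_(k < m.+1) \sum_(l < m.+1)
    coef f l * (conj (t l k) * t k m)).
  apply: eq_bigr => k _.
  have km : in_range n k by apply: in_range_le nm; apply: leq_ord.
  rewrite (@coef_bar _ _ _ m.+1) // rmorph_sum big_distrl.
  by apply: eq_bigr => l _; rewrite rmorphM conjK mulrA.
have E (l : 'I_m.+1) : \sum_(k < m.+1) coef f l * (conj (t l k) * t k m) =
    coef f l * (m == l)%:R.
  rewrite -big_distrr -coef_TX // -bar_Tbar -rmorphXn; congr (_ * _); symmetry.
  exact: coef_mk.
rewrite exchange_big (eq_bigr _ (fun l _ => E l)) (bigD1 ord_max) //=.
rewrite eqxx mulr1 big1 ?addr0 // => i.
by rewrite -val_eqE eq_sym => /negPf /= ->; rewrite mulr0.
Qed.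

Local Notation obar := (one_plus_bar n conj).

Lemma one_plus_barK : involutive obar.
Proof. by move=> u; apply: val_inj; apply: barK. Qed.

Lemma eq1_mod_bar k u : eq1_mod k u -> eq1_mod k (obar u).
Proof.
by move=> /val_ge_bar; rewrite /eq1_mod rmorphB rmorph1.
Qed.

Lemma coef_obar_lead k u : (0 < k)%N -> eq1_mod k u -> in_range n k ->
  coef (val (obar u)) k = (-1) ^+ k * conj (coef (val u) k).
Proof.
move=> k0 hu nk; have := coef_bar_lead hu nk.
by rewrite rmorphB rmorph1 !coefB coef1 gtn_eqF // !subr0.
Qed.

Lemma coef_obar_next k u : (0 < k)%N -> eq1_mod k u -> in_range n k.+1 ->
  coef (val (obar u)) k.+1 =
  (-1) ^+ k.+1 * (conj (coef (val u) k.+1) + k%:R * conj (coef (val u) k)).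
Proof.
move=> k0 hu nk; have := coef_bar_next hu nk.
by rewrite rmorphB rmorph1 !coefB !coef1 (gtn_eqF k0) !subr0.
Qed.

(** * Division by norms, two degrees at a time *)

Hypothesis n_even : even_nonzero_or_infinite n.

(** Because n is even or infinite, truncation never separates the degrees of a pair k, k + 1 with k
    odd. *)
Lemma in_range_odd k : odd k -> in_range n k -> in_range n k.+1.
Proof. by case: n n_even => [m|] //= /andP[m0 me] ok km; lia. Qed.

Lemma in_range2 : in_range n 2.
Proof. by case: n n_even => [m|] //= /andP[m0 me]; lia. Qed.

(* u / (v bar(v)), the group law of 1 + I_n being written additively *)
Definition div_norm (u v : one_plus R n) := u - (v + obar v).

Lemma div_norm_invariant u v : obar u = u -> obar (div_norm u v) = div_norm u v.
Proof.
move=> hu; rewrite /div_norm raddfB raddfD /= one_plus_barK hu.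
by rewrite [obar v + v]addrC.
Qed.

Lemma eq1_mod_div_norm k u v : (0 < k)%N -> eq1_mod k u -> eq1_mod k (v + obar v) ->
    (in_range n k -> coef (val u) k = coef (val (v + obar v)) k /\
      coef (val u) k.+1 = coef (val (v + obar v)) k.+1) ->
    (in_range n k -> in_range n k.+1) ->
  eq1_mod k.+2 (div_norm u v).
Proof.
move=> k0 hu hv h nk; apply/eq1_modB_val => j jk2; rewrite coefB.
case: (boolP (in_range n j)) => nj; last by rewrite !coef_out ?subrr.
have [jk|kj|jE] := ltngtP j k.
- have := hu j jk; have := hv j jk; rewrite !coefB => /eqP; rewrite subr_eq0.
  by move=> /eqP -> /eqP; rewrite subr_eq0 => /eqP ->; rewrite subrr.
- have jE : j = k.+1 by lia.
  rewrite jE in nj *; have [_ ->] := h (in_range_le (leqnSn k) nj).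
  by rewrite subrr.
- by rewrite jE in nj *; have [-> _] := h nj; rewrite subrr.
Qed.

Lemma eq1_mod_one_plus_of k (a : nat -> R) : (forall j, (0 < j < k)%N -> a j = 0) ->
  eq1_mod k (one_plus_of n a).
Proof.
move=> ha [|j] jk; rewrite coefB coef1; first by rewrite coef0_one_plus subrr.
case: (boolP (in_range n j.+1)) => nj; last by rewrite coef_out ?subrr.
by rewrite coef_one_plus_of // ha ?subr0.
Qed.

Lemma div_norm_odd k u : odd k -> (2 < k)%N -> obar u = u -> eq1_mod k u ->
  exists2 v, eq1_mod k v & eq1_mod k.+2 (div_norm u v).
Proof.
move=> ok k2 ubar hu; set a := coef (val u) k; set b := coef (val u) k.+1.
have k0 : (0 < k)%N by apply: leq_trans k2.
have kE : k = k./2.*2.+1 by rewrite -[LHS]odd_double_half ok.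
pose m : R := (k./2)%:R; have kR : k%:R = m + m + 1 :> R.
  by rewrite kE -natr1 -addnn natrD.
(* Invariance of u means a = - conj a and b - conj b = - k a; with k = 2 m + 1,
   c = - b - m a and d = (1 + m) b then solve the equations
   c - conj c = a and d + conj d + k conj c = b for 1 + c T^k + d T^(k+1). *)
pose s j := if (j == k)%N then - b - m * a
            else if (j == k.+1)%N then (1 + m) * b else 0.
pose v := one_plus_of n s.
have hv : eq1_mod k v.
  apply: eq1_mod_one_plus_of => j; rewrite /s => /andP[_ jk].
  by rewrite !ltn_eqF // ltnW.
exists v => //; apply: eq1_mod_div_norm => //; last exact: in_range_odd.
  by apply: eq1_modD => //; apply: eq1_mod_bar.
move=> nk; have nk1 := in_range_odd ok nk.
have ek : coef (val v) k = - b - m * a.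
  have -> : - b - m * a = s k by rewrite /s eqxx.
  by case: (k) k0 nk => // k' _ nk'; rewrite coef_one_plus_of.
have ek1 : coef (val v) k.+1 = (1 + m) * b.
  by rewrite coef_one_plus_of // /s gtn_eqF ?eqxx.
have sgn : (-1) ^+ k = -1 :> R by rewrite -signr_odd ok expr1.
have sgn1 : (-1) ^+ k.+1 = 1 :> R by rewrite exprS sgn mulN1r opprK.
have aE : a = - conj a.
  by rewrite {1}/a -ubar coef_obar_lead // sgn mulN1r.
have bE : b = conj b + k%:R * conj a.
  by rewrite {1}/b -ubar coef_obar_next // sgn1 mul1r.
have hbv : eq1_mod k (obar v) by apply: eq1_mod_bar.
(* Since k > 2, the degree k + 1 is still below 2 k, so both coefficients of the norm are sums. *)
rewrite !(coefM_one_plus hv hbv); [|lia..].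
rewrite coef_obar_lead // coef_obar_next // sgn sgn1 mulN1r mul1r.
rewrite -/a -/b ek ek1.
have cm : conj m = m by rewrite rmorph_nat.
rewrite !(rmorphB, rmorphN, rmorphM, rmorphD, rmorph1) /= cm.
set A := conj a in aE bE *; set B := conj b in bE *.
have BE : B = b - k%:R * A by rewrite bE; ring.
rewrite BE aE kR; split; ring.
Qed.

(** The equation says that b conj b represents (1 + q)[x] in H^0(R), that is, lambda kills the class
    of u. It is what allows the first pair of degrees, 1 and 2, to be cleared. *)
Lemma div_norm_first u x y : obar u = u -> conj x = x ->
    coef (val u) 2 * conj (coef (val u) 2) = x + x ^+ 2 + (y + conj y) ->
  exists v, eq1_mod 3 (div_norm u v).
Proof.
move=> ubar xbar; set a := coef (val u) 1; set b := coef (val u) 2 => bbE.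
(* The norm of 1 + c T + d T^2 has coefficients c - conj c and
   d + conj d + conj c - c conj c; invariance of u means a = conj b - b. *)
pose s j := if (j == 1)%N then x - b
            else if (j == 2)%N then b - x * b + x ^+ 2 + y else 0.
pose v := one_plus_of n s; exists v.
have n2 := in_range2; have n1 : in_range n 1 by apply: in_range_le n2.
apply: eq1_mod_div_norm => //; try exact: eq1_mod1; move=> _.
have aE : a = - conj a.
  by rewrite {1}/a -ubar coef_obar_lead //; [rewrite expr1 mulN1r | exact: eq1_mod1].
have bE : b = conj b + conj a.
  rewrite {1}/b -ubar coef_obar_next //; last exact: eq1_mod1.
  by rewrite sqrrN expr1n !mul1r.
have e1 : coef (val v) 1 = x - b by rewrite coef_one_plus_of.
have e2 : coef (val v) 2 = b - x * b + x ^+ 2 + y by rewrite coef_one_plus_of.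
have f1 : coef (val (obar v)) 1 = - conj (x - b).
  by rewrite coef_obar_lead ?e1 //; [rewrite expr1 mulN1r | exact: eq1_mod1].
have f2 : coef (val (obar v)) 2 = conj (b - x * b + x ^+ 2 + y) + conj (x - b).
  rewrite coef_obar_next ?e1 ?e2 //; last exact: eq1_mod1.
  by rewrite sqrrN expr1n !mul1r.
have l1 (w : one_plus R n) := @eq1_mod1 R n w.
rewrite (coefM_one_plus (l1 _) (l1 _)) // coef2_one_plusD // e1 e2 f1 f2 -/a -/b.
rewrite !(rmorphB, rmorphN, rmorphM, rmorphD, rmorphXn) /= xbar.
set A := conj a in aE bE *; set B := conj b in bE bbE *; set Y := conj y in bbE *.
have AE : A = b - B by rewrite bE; ring.
have YE : y + Y = b * B - x - x ^+ 2 by rewrite bbE; ring.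
split; first by rewrite aE AE; ring.
have -> : Y = b * B - x - x ^+ 2 - y by rewrite -YE; ring.
ring.
Qed.

Lemma one_plus_barD (u v : one_plus R n) : obar (u + v) = obar u + obar v.
Proof. exact: raddfD. Qed.

Lemma div_normD (u v w : one_plus R n) :
  div_norm u (v + w) = div_norm (div_norm u v) w.
Proof. by rewrite /div_norm one_plus_barD addrACA opprD addrA. Qed.

(** The corrections given by [div_norm_odd] in degrees 3, 5, 7, ... have a T-adically convergent
    product, whose norm is u. *)
Lemma eq1_mod3_is_norm u : obar u = u -> eq1_mod 3 u -> exists v, u = v + obar v.
Proof.
move=> ubar hu.
(* A total choice of corrections; the value is 0 where [div_norm_odd] does not apply. *)
have /choice[S HS] (p : nat * one_plus R n) : exists v,
    odd p.1 -> (2 < p.1)%N -> obar p.2 = p.2 -> eq1_mod p.1 p.2 ->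
    eq1_mod p.1 v /\ eq1_mod p.1.+2 (div_norm p.2 v).
  case: p => k w /=; have [[ok k2 wbar hw]|no] :=
    pselect [/\ odd k, (2 < k)%N, obar w = w & eq1_mod k w].
    by have [v hv hwv] := div_norm_odd ok k2 wbar hw; exists v.
  by exists 0 => ok k2 wbar hw; case: no.
(* [r j] runs through the odd degrees from 3 on, and [G j] is the product of the first j
   corrections. *)
pose r j := j.*2.+3.
pose G j := iteri j (fun i g => g + S (r i, div_norm u g)) 0.
have GS j : G j.+1 = G j + S (r j, div_norm u (G j)) by [].
have Gstep j : eq1_mod (r j) (div_norm u (G j)) ->
    eq1_mod (r j) (S (r j, div_norm u (G j))) /\ eq1_mod (r j.+1) (div_norm u (G j.+1)).
  move=> hj; have rodd : odd (r j) by rewrite /r /= negbK odd_double.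
  have [] := HS (r j, div_norm u (G j)) rodd isT (div_norm_invariant _ ubar) hj.
  by rewrite GS div_normD.
have GI j : eq1_mod (r j) (div_norm u (G j)).
  elim: j => [|j /Gstep[]//].
  by rewrite /div_norm raddf0 addr0 subr0.
have Gmono i j : (i <= j)%N -> eq1_mod (r i) (G j - G i).
  move=> ij; rewrite -(subnKC ij); elim: (j - i)%N => [|d IH].
    by rewrite addn0 subrr; apply: one_eq1_mod.
  rewrite addnS GS addrAC; apply: eq1_modD => //.
  have [hS _] := Gstep _ (GI (i + d)%N).
  by apply: val_geW hS; rewrite /r; lia.
(* The products [G j] with j >= k agree below degree [r k] = 2 k + 3 > k, so [G k] already has the
   limiting coefficient of T^k. *)
pose L := one_plus_of n (fun k => coef (val (G k)) k).
have LG j : eq1_mod (r j) (L - G j).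
  apply/eq1_modB_val => -[|i] ij; rewrite coefB; first by rewrite !coef0_one_plus subrr.
  case: (boolP (in_range n i.+1)) => ni; last by rewrite !coef_out ?subrr.
  rewrite coef_one_plus_of //; have [ji|ji] := leqP j i.+1.
    by have /eq1_modB_val/(_ _ ij) := Gmono _ _ ji; rewrite coefB.
  have /eq1_modB_val := Gmono _ _ (ltnW ji); move/(_ i.+1); rewrite coefB => E.
  by rewrite -opprB E ?oppr0 // /r; lia.
exists L; apply/eqP; rewrite -subr_eq0; apply/eqP; apply: eq1_mod_eq0 => k.
(* Passing from [G k] to L changes the quotient only by a factor congruent to 1 modulo T^(r k). *)
have -> : u - (L + obar L) = div_norm (div_norm u (G k)) (L - G k).
  by rewrite -div_normD [G k + _]addrC subrK.
apply: (@val_geW _ _ (r k)); first by rewrite /r; lia.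
by apply: eq1_modD (GI k) (eq1_modN (eq1_modD (LG k) (eq1_mod_bar (LG k)))).
Qed.

(** * The homomorphism lambda *)

Definition norm_coef2 (f : invariants obar) : H0 conj :=
  H0_class (norm conjK (coef (val (val f)) 2)).

Lemma one_plus_bar_invariant (f : invariants obar) : obar (val f) = val f.
Proof. exact: eqP (valP f). Qed.

(** Degree 2 of f = bar(f) reads b = conj b + conj a, and degree 1 reads a = - conj a. *)
Lemma coef1_invariant (f : invariants obar) :
  coef (val (val f)) 1 = conj (coef (val (val f)) 2) - coef (val (val f)) 2.
Proof.
have n2 := in_range2; have n1 : in_range n 1 by apply: in_range_le n2.
have := coef_obar_next (ltn0Sn 0) (@eq1_mod1 _ _ (val f)) n2.
have := coef_obar_lead (ltn0Sn 0) (@eq1_mod1 _ _ (val f)) n1.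
rewrite one_plus_bar_invariant sqrrN expr1n !mul1r expr1 mulN1r.
by move=> E1 E2; rewrite {2}E2 opprD addNKr.
Qed.

Lemma val_invariantsD (A : zmodType) (t : {additive A -> A}) (x y : invariants t) :
  val (x + y) = val x + val y.
Proof. by []. Qed.

Lemma norm_coef2D f g : norm_coef2 (f + g) = norm_coef2 f + norm_coef2 g.
Proof.
rewrite /norm_coef2 -raddfD; apply/H0_conjP.
rewrite val_invariantsD coef2_one_plusD ?in_range2 // !coef1_invariant.
set b := coef _ 2; set b' := coef _ 2.
(* The cross term (conj b - b)(conj b' - b') equals y + conj y, so its square is y (y + conj y) plus
   the conjugate of that. *)
pose y := b * b' - b * conj b'.
exists (b * conj b' + (b + b') * ((conj b - b) * (conj b' - b')) +
        y * (y + conj y)).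
rewrite [LHS]/= /y !(rmorphB, rmorphM, rmorphD) /= !conjK.
set B := conj b; set B' := conj b'; ring.
Qed.

(** This makes lambda well defined: representatives of a class differ by norms, which land in the
    image of 1 + q. *)
Lemma norm_coef2_norm f c : val f = c + obar c ->
  norm_coef2 f = one_plus_q (H0_class (norm conjK (coef (val c) 1))).
Proof.
move=> fE; rewrite /norm_coef2 /one_plus_q q_class -raddfD; apply/H0_conjP.
have n2 := in_range2; have n1 : in_range n 1 by apply: in_range_le n2.
rewrite fE coef2_one_plusD // (coef_obar_next _ (@eq1_mod1 _ _ _)) //.
rewrite (coef_obar_lead _ (@eq1_mod1 _ _ _)) // expr1 sqrrN expr1n !mul1r mulN1r.
rewrite val_invariantsD.
set x := coef _ 1; set d := coef _ 2.
(* With s = d + conj d - x conj x, fixed by [conj], the coefficient is s + conj x, of norm s^2 + s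
   (x + conj x) + x conj x. The last summand of the witness yields s (x + conj x), the others s^2 -
   (x conj x)^2. *)
exists (d * (d + conj d) - (d + conj d) * (x * conj x) +
        (d + conj d - x * conj x) * x).
rewrite [LHS]/= !(rmorphB, rmorphM, rmorphD, rmorphN) /= !conjK.
set X := conj x; set D := conj d; ring.
Qed.

Lemma C_classP (X Y : H0 conj) :
  C_class X = C_class Y <-> exists Z, X - Y = one_plus_q Z.
Proof.
split=> [/eqP|] E.
  by move: E; rewrite /C_class /coker_class -Quotient.idealrBE inE => /asboolP.
by apply/eqP; rewrite /C_class /coker_class -Quotient.idealrBE inE; apply/asboolP.
Qed.

Lemma C_classD (X Y : H0 conj) : C_class (X + Y) = C_class X + C_class Y.
Proof. exact: (raddfD (\pi_(Quotient.quot (in_image (@one_plus_q R conj)))%qT)). Qed.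

Definition lambda (X : H0 obar) : C conj := C_class (norm_coef2 (repr X)).

Lemma lambda_class f : lambda (H0_class f) = C_class (norm_coef2 f).
Proof.
have /H0_classP[c] : H0_class (repr (H0_class f)) = H0_class f by apply: reprK.
rewrite /lambda; set g := repr _ => E; apply/C_classP.
exists (H0_class (norm conjK (coef (val c) 1))).
rewrite -(norm_coef2_norm (f := g - f)).
  by rewrite -{1}[g](subrK f) norm_coef2D addrK.
by rewrite -E.
Qed.

Fact lambda_additive : zmod_morphism lambda.
Proof.
have D X Y : lambda (X + Y) = lambda X + lambda Y.
  have [x <-] := H0_class_surj X; have [y <-] := H0_class_surj Y.
  by rewrite -raddfD !lambda_class norm_coef2D C_classD.
by move=> X Y; apply: (addIr (lambda Y)); rewrite -D !subrK.
Qed.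

HB.instance Definition _ :=
  GRing.isZmodMorphism.Build (H0 obar) (C conj) lambda lambda_additive.

Definition lambda_hom : {additive H0 obar -> C conj} := lambda.

(** * Bijectivity of lambda *)

Lemma C_class0 : C_class (0 : H0 conj) = 0.
Proof. by apply: (addIr (C_class 0)); rewrite -C_classD !add0r. Qed.

(** A class in the kernel satisfies the equation of [div_norm_first]; after division by a norm it is
    congruent to 1 modulo T^3, hence itself a norm. *)
Lemma lambda_inj : injective lambda.
Proof.
apply: raddf_inj => X; have [f <-] := H0_class_surj X.
rewrite /= lambda_class -C_class0 => /C_classP[Z]; rewrite subr0.
have [z <-] := H0_class_surj Z.
rewrite /norm_coef2 /one_plus_q q_class -raddfD => /H0_conjP[y].
rewrite val_invariantsD => E.
have [v hv] : exists v, eq1_mod 3 (div_norm (val f) v).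
  apply: (@div_norm_first _ (val z) y) (conj_invariant z) _.
    exact: one_plus_bar_invariant.
  by move/eqP: E; rewrite subr_eq addrC => /eqP.
have [w] := eq1_mod3_is_norm (div_norm_invariant _ (one_plus_bar_invariant f)) hv.
move=> /eqP; rewrite subr_eq => /eqP fE.
rewrite -[RHS](raddf0 (@H0_class _ (one_plus_bar n conj))).
apply/H0_classP; exists (w + v); rewrite [LHS]subr0.
by rewrite [RHS](_ : _ = w + v + obar (w + v)) // one_plus_barD addrACA.
Qed.

(** The involution swaps the factors of T bar(T) = - T^2 + ... and fixes the constant x, so 1 - x T
    bar(T) is invariant. *)
Lemma exists_invariant_coef2 (x : R) : conj x = x ->
  exists f : invariants obar, coef (val (val f)) 2 = x.
Proof.
move=> xbar; pose K := mk_tps n (fun j => if j is 0 then x else 0).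
have Kbar : bar conj K = K.
  apply: tpsP => m nm; rewrite [LHS]coef_mk // big_ord_recl big1 => [|i _].
    rewrite coef_mk; last exact: in_range_le nm.
    rewrite [LHS]addr0 xbar expr0 coef1 [RHS]coef_mk //.
    by case: m {nm} => [|m]; rewrite ?mulr1 ?mulr0.
  rewrite coef_mk; last by apply: in_range_le nm; apply: ltn_ord.
  by rewrite rmorph0 mul0r.
pose s := tpsT R n * Tb; have sbar : bar conj s = s.
  by rewrite /s rmorphM /= bar_T bar_Tbar mulrC.
have vs : val_ge 2 s := val_geM (val_geT R n) val_geTbar.
have n2 := in_range2; have n1 : in_range n 1 by apply: in_range_le n2.
have uP : is_one_plus (1 - K * s).
  apply/is_one_plusP; rewrite addrC addKr; apply/val_geN/val_geMl.
  exact: val_geW vs.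
have ubar : is_invariant obar (OnePlus uP).
  apply/eqP/val_inj; rewrite /= rmorphB rmorph1 rmorphM /= Kbar.
  by rewrite -/s sbar.
exists (Invariants ubar); rewrite -[LHS]/(coef (1 - K * s) 2) coefB coef1 sub0r.
have -> : coef (K * s) 2 = coef K 0 * coef s 2.
  by rewrite -[2%N]/(0 + 2)%N coefM_lead.
rewrite coef_mk; last exact: in_range_le n2.
by rewrite coefTM // coef_Tbar // expr1 mulrN1 opprK.
Qed.

Lemma lambda_surj Y : exists X, lambda X = Y.
Proof.
have [y yE] := H0_class_surj (repr Y : H0 conj).
(* For b = - y one has b conj b = y^2, and y^2 - y = b + b^2 lies in the image of 1 + q. *)
have [|f fE] := @exists_invariant_coef2 (val (- y)); first exact: conj_invariant.
exists (H0_class f); rewrite lambda_class -[RHS]reprK; apply/C_classP.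
exists (H0_class (- y)); rewrite -[repr Y]yE /one_plus_q addrC -raddfN q_class.
congr (_ + H0_class _); apply: val_inj.
by rewrite /= fE conj_invariant.
Qed.

Lemma lambda_bij : bijective lambda.
Proof.
have [mu muK] := choice lambda_surj.
by exists mu => // X; apply: lambda_inj; rewrite muK.
Qed.

End Bar.

Theorem proposition3p4 (R : comPzRingType) (conj : {rmorphism R -> R})
    (conjK : involutive conj) (n : option nat)
    (hn : even_nonzero_or_infinite n) :
  exists lambda : {additive H0 (one_plus_bar n conj) -> C conj},
    (forall f : invariants (one_plus_bar n conj),
       lambda (H0_class f) =
       C_class (H0_class (norm conjK (coef (val (val f)) 2)))) /\
    bijective lambda.
Proof.
exists (lambda_hom conjK hn); split; last exact: (lambda_bij conjK hn).
exact: (lambda_class conjK hn).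
Qed.
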